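(* Let $G$ be a connected and simply connected solvable Lie group with Lie algebra $\mathfrak{g}$. If $\mathcal{O}\in(\mathfrak{g}^*/G)^{\sim}$ is a coadjoint quasi-orbit that is open in $\mathfrak{g}^*$, then $\mathcal{O}\subseteq\mathfrak{g}^*_{\mathrm{gen}}$.
   Context: $G$ acts on $\mathfrak{g}^*$ by the coadjoint action $(g,\xi)\mapsto g\xi$. Two elements $\xi,\eta\in\mathfrak{g}^*$ are equivalent if $\overline{G\xi}=\overline{G\eta}$; the equivalence classes are the coadjoint quasi-orbits, and $(\mathfrak{g}^*/G)^{\sim}$ is the set of them. For $\xi\in\mathfrak{g}^*$ let $\mathfrak{g}(\xi)=\{x\in\mathfrak{g}:\langle\xi,[x,y]\rangle=0\ \text{for all } y\in\mathfrak{g}\}$. Let $k_0=\min\{\dim\mathfrak{g}(\xi):\xi\in\mathfrak{g}^*\}$ and $\mathfrak{g}^*_{\mathrm{gen}}=\{\xi\in\mathfrak{g}^*:\dim\mathfrak{g}(\xi)=k_0\}$, the union of all coadjoint orbits of maximal dimension. *)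

(* Defs.v *)
From HB Require Import structures.
From mathcomp Require Import all_boot all_order all_algebra.
From mathcomp Require Import all_classical all_reals all_analysis.

Set Implicit Arguments.
Unset Strict Implicit.
Unset Printing Implicit Defensive.
Import Order.TTheory GRing.Theory Num.Theory.
Import numFieldNormedType.Exports.
Local Open Scope classical_set_scope.
Local Open Scope ring_scope.

Section Smooth.
Context {R : realType} {V W : normedModType R}.

(* Only meant for open U: then the ambient 'd f x is the differential of the
   restriction of f to U. *)
Fixpoint Ck_on (k : nat) (U : set V) (f : V -> W) : Prop :=
  match k with
  | 0 => {within U, continuous f}
  | k'.+1 => (forall x, U x -> differentiable f x) /\
             (forall v : V, Ck_on k' U (fun x => 'd f x v))
  end.

Definition smooth_on (U : set V) (f : V -> W) := forall k, Ck_on k U f.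

End Smooth.

Section Charts.
Context {R : realType} {T : topologicalType} {n : nat}.

(* A homeomorphism from an open subset of T onto an open subset of R^n; the
   total functions carry no information outside these sets. *)
Record chart := Chart {
  chart_dom : set T;
  chart_fun :> T -> 'rV[R]_n;
  chart_inv : 'rV[R]_n -> T;
  chart_dom_open : open chart_dom;
  chart_img_open : open (chart_fun @` chart_dom);
  chart_funK : {in chart_dom, cancel chart_fun chart_inv};
  chart_fun_continuous : {within chart_dom, continuous chart_fun};
  chart_inv_continuous :
    {within chart_fun @` chart_dom, continuous chart_inv} }.

Definition chart_img (c : chart) : set 'rV[R]_n := c @` chart_dom c.

Definition smooth_atlas (A : set chart) : Prop :=
  (forall p : T, exists2 c, A c & chart_dom c p) /\
  (forall c d, A c -> A d ->
     smooth_on (c @` (chart_dom c `&` chart_dom d)) (d \o chart_inv c)).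

End Charts.
Arguments chart R T n : clear implicits.

#[short(type="topGroupType")]
HB.structure Definition TopGroup := {G of Topological G & Group G}.

Record lieGroupType (R : realType) (n : nat) := LieGroup {
  lie_sort :> topGroupType;
  lie_atlas : set (chart R lie_sort n);
  lie_hausdorff : hausdorff_space lie_sort;
  lie_second_countable : @second_countable lie_sort;
  lie_smooth_atlas : smooth_atlas lie_atlas;
  lie_mul_continuous :
    continuous (fun gh : lie_sort * lie_sort => (gh.1 * gh.2)%g);
  lie_inv_continuous : continuous (fun g : lie_sort => (g^-1)%g);
  lie_mul_smooth : forall c d e,
    lie_atlas c -> lie_atlas d -> lie_atlas e ->
    smooth_on
      [set pq : 'rV[R]_n * 'rV[R]_n |
        [/\ chart_img c pq.1, chart_img d pq.2 &
            chart_dom e (chart_inv c pq.1 * chart_inv d pq.2)%g]]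
      (fun pq => e (chart_inv c pq.1 * chart_inv d pq.2)%g);
  lie_inv_smooth : forall c d, lie_atlas c -> lie_atlas d ->
    smooth_on
      [set p : 'rV[R]_n |
        chart_img c p /\ chart_dom d ((chart_inv c p)^-1)%g]
      (fun p => d ((chart_inv c p)^-1)%g) }.

(* Contractibility of loops only: no connectedness is built in. *)
Definition simply_connected (R : realType) (T : topologicalType) : Prop :=
  forall gamma : R -> T,
    {within `[0, 1], continuous gamma} -> gamma 0 = gamma 1 ->
    exists H : R * R -> T,
      [/\ {within `[0, 1] `*` `[0, 1], continuous H},
          forall t, t \in `[0, 1] -> H (0, t) = gamma t,
          forall t, t \in `[0, 1] -> H (1, t) = gamma 0 &
          forall s, s \in `[0, 1] -> H (s, 0) = gamma 0 /\ H (s, 1) = gamma 0].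

Section Solvable.
Context {G : groupType}.
Implicit Types A H : set G.

Definition subgroup H : Prop :=
  H 1%g /\ forall x y, H x -> H y -> H (x * y^-1)%g.

Definition derived_subgroup A : set G :=
  smallest subgroup [set z | exists x y, [/\ A x, A y & z = [~ x, y]%g]].

End Solvable.

Definition solvable_group (G : groupType) : Prop :=
  exists k, iter k derived_subgroup [set: G] = [set 1%g].

(* The rank of a set of row vectors: the largest number of linearly
   independent vectors in it, i.e. its dimension when it is a subspace. *)
Definition set_dim (R : realType) (n : nat) (A : set 'rV[R]_n) : nat :=
  \max_(k < n.+1 |
    `[< exists2 M : 'M[R]_(k, n), row_free M & forall i, A (row i M) >]) k.

Section Coadjoint.
Context {R : realType} {n : nat} {G : lieGroupType R n}.
(* A chart c around 1 identifies the tangent space at 1, hence the Lie algebra,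
   with row vectors 'rV_n, and its dual with column vectors 'cV_n. *)
Variable c : chart R G n.

(* The matrix, acting on row vectors from the right, of the differential at 1
   of h |-> g h g^-1. *)
Definition Ad (g : G) : 'M[R]_n :=
  jacobian (fun p => c (g * chart_inv c p * g^-1)%g) (c 1%g).

(* [x, y] = d(Ad)_1 (x) (y) *)
Definition lie_bracket (x y : 'rV[R]_n) : 'rV[R]_n :=
  'd (fun p : 'rV[R]_n => y *m Ad (chart_inv c p)) (c 1%g) x.

Definition pairing (xi : 'cV[R]_n) (x : 'rV[R]_n) : R := (x *m xi) ord0 ord0.

(* <g xi, x> = <xi, Ad(g^-1) x> *)
Definition coad (g : G) (xi : 'cV[R]_n) : 'cV[R]_n := Ad (g^-1)%g *m xi.

Definition coad_orbit (xi : 'cV[R]_n) : set 'cV[R]_n := range (coad^~ xi).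

Definition coad_quasi_orbit (xi : 'cV[R]_n) : set 'cV[R]_n :=
  [set eta | closure (coad_orbit xi) = closure (coad_orbit eta)].

Definition coad_quasi_orbits : set (set 'cV[R]_n) := range coad_quasi_orbit.

Definition lie_stab (xi : 'cV[R]_n) : set 'rV[R]_n :=
  [set x | forall y, pairing xi (lie_bracket x y) = 0].

Lemma lie_stab_dim_ex :
  exists k, `[< exists xi, set_dim (lie_stab xi) = k >].
Proof. by exists (set_dim (lie_stab 0)); apply/asboolP; exists 0. Qed.

Definition min_stab_dim : nat := ex_minn lie_stab_dim_ex.

Definition generic_dual : set 'cV[R]_n :=
  [set xi | set_dim (lie_stab xi) = min_stab_dim].

End Coadjoint.

(* Main.v *)
From HB Require Import structures.
Require Import Defs.
From mathcomp Require Import all_boot all_order all_algebra.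
From mathcomp Require Import all_classical all_reals all_analysis.

(** The coadjoint orbits in an open quasi-orbit [Q] have the same closure, and
    [Q] is contained in it; so it suffices that the generic set is open, dense
    and stable under the group.  Indeed density gives a generic [zeta] in [Q];
    for [eta] in [Q] the point [zeta] lies in the closure of the orbit of
    [eta], that orbit therefore meets the open generic set, and stability moves
    genericity back along the orbit to [eta].

    The three properties are read off from the Kirillov matrix
    [B xi = (<xi, [e_i, e_j]>)_(i, j)], for which the stabiliser of [xi] is the
    left kernel of [B xi] and thus has dimension [n - rank (B xi)]
    ([set_dim_radical]): being generic means that the rank is maximal.
    - The rank of [B xi] is the size of some invertible [L *m B xi *m T], whose
      determinant stays nonzero nearby, so the rank is lower semicontinuous
      ([rank_lsc]).
    - [B] is linear, so on a line in the direction of a point of maximal rank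
      such a determinant is a nonzero polynomial, and maximal rank occurs on
      every nonempty open set ([rank_dense]).
    - [Ad g] preserves the bracket ([lie_bracket_Ad]), so [B (g xi)] is a
      congruence transform of [B xi] and its rank cannot exceed that of [B xi]
      ([form_mx_mul]).

    The remaining work is differential: in a chart around the unit, conjugations
    are differentiable, [Ad] is multiplicative by the chain rule, and [Ad] is
    itself differentiable at the unit because the multiplication is twice
    differentiable ([differentiable_Ad_chart]); the last point is what makes the
    bracket bilinear ([lie_bracketDr]). *)

Set Implicit Arguments.
Unset Strict Implicit.
Unset Printing Implicit Defensive.
Import Order.TTheory GRing.Theory Num.Theory.
Import numFieldNormedType.Exports.
Local Open Scope classical_set_scope.
Local Open Scope ring_scope.

(** * Differential calculus *)

Section Calculus.
Context {R : realType}.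

(** Differentials are local: group identities below hold in a chart only near
    a point, and this transfers them to the differentials. *)
Lemma near_eq_diff (V W : normedModType R) (f g : V -> W) (x : V) :
  (\forall y \near x, f y = g y) -> differentiable f x ->
  differentiable g x /\ 'd g x = 'd f x :> (V -> W).
Proof.
move=> fg df.
have fgx : f x = g x by exact: (nbhs_singleton fg).
have dg : g \o shift x = cst (g x) + 'd f x +o_ 0 id.
  apply/eqaddoP => _/posnumP[e].
  have /eqaddoP/(_ _ (gt0 e)) := diff_locally df.
  apply: filter_app.
  have : \forall h \near 0, f (h + x) = g (h + x).
    by have := near_shift 0 x (fun y => f y = g y); rewrite subr0 => <-.
  by apply: filterS => h; rewrite !fctE /= fgx => ->.
have eq_d : 'd g x = 'd f x :> (V -> W).
  by apply: diff_unique => //; exact: diff_continuous.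
split=> //; apply/diff_locallyP; rewrite eq_d; split=> //.
exact: diff_continuous.
Qed.

Lemma near_eq_diffE (V W : normedModType R) (f g : V -> W) (x v : V) :
  (\forall y \near x, f y = g y) -> differentiable f x ->
  'd g x v = 'd f x v.
Proof. by move=> fg df; rewrite (near_eq_diff fg df).2. Qed.

Lemma diff_compE (U V W : normedModType R) (f : U -> V) (g : V -> W) (x v : U) :
  differentiable f x -> differentiable g (f x) ->
  'd (fun y => g (f y)) x v = 'd g (f x) ('d f x v).
Proof. by move=> df dg; exact: (congr1 (@^~ v) (diff_comp df dg)). Qed.

Lemma diff_pairE (U V W : normedModType R) (f : U -> V) (g : U -> W) (x v : U) :
  differentiable f x -> differentiable g x ->
  'd (fun y => (f y, g y)) x v = ('d f x v, 'd g x v).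
Proof. by move=> df dg; exact: (congr1 (@^~ v) (diff_pair df dg)). Qed.

Lemma diff_cstE (V W : normedModType R) (a : W) (x v : V) :
  'd (fun=> a) x v = 0.
Proof. exact: (congr1 (@^~ v) (diff_cst a x)). Qed.

Lemma diff_idE (V : normedModType R) (x v : V) : 'd (fun y : V => y) x v = v.
Proof.
exact: (congr1 (@^~ v) (@diff_val _ _ _ _ _ (fun y : V => y) _ (is_diff_id x))).
Qed.

Lemma is_diff_partial2 (U V W : normedModType R) (f : U * V -> W) (a : U) (b v : V) :
  differentiable f (a, b) ->
  differentiable (fun y => f (a, y)) b /\
  'd (fun y => f (a, y)) b v = 'd f (a, b) (0, v).
Proof.
move=> df; have da : differentiable (fun y : V => (a, y)) b.
  exact: differentiable_pair.
split; first exact: (differentiable_comp da df).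
by rewrite (diff_compE v da df) diff_pairE// diff_cstE diff_idE.
Qed.

Lemma is_diff_partial1 (T U V W : normedModType R) (f : U * V -> W) (g : T -> U)
    (a w : U) (b : V) (x v : T) :
  differentiable g x -> g x = a -> 'd g x v = w -> differentiable f (a, b) ->
  differentiable (fun y => f (g y, b)) x /\
  'd (fun y => f (g y, b)) x v = 'd f (a, b) (w, 0).
Proof.
move=> dg <- <- df; have db : differentiable (fun y => (g y, b)) x.
  exact: differentiable_pair.
split; first exact: (differentiable_comp db df).
by rewrite (diff_compE v db df) diff_pairE// diff_cstE.
Qed.

Lemma diff_linear_comb (V W : normedModType R) a (f g : V -> W) (x v : V) :
  differentiable f x -> differentiable g x ->
  'd (fun y => a *: f y + g y) x v = a *: 'd f x v + 'd g x v.
Proof.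
move=> df dg.
transitivity ('d (a *: f + g) x v); first by [].
by rewrite diffD ?diffZ //; exact: differentiableZ.
Qed.

Lemma differentiable_row (V : normedModType R) n (f : V -> 'rV[R]_n) (x : V) :
  (forall j, differentiable (fun y => f y ord0 j) x) -> differentiable f x.
Proof.
move=> df.
have -> : f = \sum_(j < n) (fun y => f y ord0 j *: delta_mx ord0 j).
  by apply/funext => y; rewrite fct_sumE -row_sum_delta.
by apply: differentiable_sum => j; exact: differentiableZl.
Qed.

Lemma differentiable_coordf (V : normedModType R) m n (f : V -> 'M[R]_(m, n))
    (x : V) i j :
  differentiable f x -> differentiable (fun y => f y i j) x.
Proof.
move=> df; apply: (@differentiable_comp _ _ _ _ f (fun M => M i j)) => //.
exact: differentiable_coord.
Qed.

Lemma differentiable_scale (V : normedModType R) n (s : V -> R)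
    (f : V -> 'rV[R]_n) (x : V) :
  differentiable s x -> differentiable f x ->
  differentiable (fun y => s y *: f y) x.
Proof.
move=> ds df; apply: differentiable_row => j.
under eq_fun do rewrite mxE.
by apply: differentiableM => //; exact: differentiable_coordf.
Qed.

Lemma linear_pair0_sum (U W : lmodType R) n (L : {linear ('rV[R]_n * U)%type -> W})
    (w : 'rV[R]_n) :
  L (w, 0) = \sum_(j < n) w ord0 j *: L (delta_mx ord0 j, 0).
Proof.
pose J (u : 'rV[R]_n) : ('rV[R]_n * U)%type := (u, 0).
have JL : linear J by move=> a u v; rewrite /J; congr (_, _); rewrite /= scaler0 addr0.
pose JM := GRing.isLinear.Build _ _ _ _ _ JL.
pose JJ : {linear _ -> _} := HB.pack J JM.
have -> : L (w, 0) = (L \o JJ) w by [].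
rewrite [X in (L \o JJ) X]row_sum_delta linear_sum; apply: eq_bigr => j _.
by rewrite linearZ.
Qed.

(** A product rule: expanding [w y] in the standard basis makes [L y (w y, 0)]
    a finite sum of products of differentiable functions. *)
Lemma differentiable_linear_family (V U : normedModType R) n k
    (L : V -> {linear ('rV[R]_n * U)%type -> 'rV[R]_k}) (w : V -> 'rV[R]_n) (x : V) :
  (forall u, differentiable (fun y => L y (u, 0)) x) -> differentiable w x ->
  differentiable (fun y => L y (w y, 0)) x.
Proof.
move=> dL dw.
have -> : (fun y => L y (w y, 0)) =
    \sum_(j < n) (fun y => w y ord0 j *: L y (delta_mx ord0 j, 0)).
  by apply/funext => y; rewrite fct_sumE linear_pair0_sum.
apply: differentiable_sum => j; apply: differentiable_scale => //.
exact: differentiable_coordf.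
Qed.

Lemma differentiable_mulmxr m n (A : 'M[R]_(m, n)) (v : 'rV[R]_m) :
  differentiable (mulmxr A : 'rV[R]_m -> 'rV[R]_n) v.
Proof.
have -> : (mulmxr A : 'rV[R]_m -> 'rV[R]_n) =
    \sum_(i < m) (fun v : 'rV[R]_m => v ord0 i *: row i A).
  by apply/funext => w; rewrite fct_sumE /= mulmx_sum_row.
apply: differentiable_sum => i; apply: differentiableZl.
exact: differentiable_coord.
Qed.

Lemma diff_mulmxr_comp (V : normedModType R) m n (A : 'M[R]_(m, n))
    (f : V -> 'rV[R]_m) (x h : V) :
  differentiable f x ->
  'd (fun y => f y *m A) x h = 'd f x h *m A.
Proof.
move=> df; have := diff_comp df (differentiable_mulmxr A (f x)).
move=> /(congr1 (fun F => F h)) /= ->.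
rewrite diff_lin // => w; apply: differentiable_continuous.
exact: differentiable_mulmxr.
Qed.

End Calculus.

(** * Rank of matrices depending on a parameter *)

Section LinearAlgebra.
Context {R : realType} {n : nat}.

Lemma mulmx_conj (y : 'rV[R]_n) (A A' K X : 'M[R]_n) :
  A *m A' = 1%:M -> X = A' *m (K *m A) -> y *m A *m X = y *m K *m A.
Proof.
by move=> AA' ->; rewrite mulmxA -(mulmxA y) AA' mulmx1 mulmxA.
Qed.

Lemma set_dim_kernel (B : 'M[R]_n) :
  set_dim [set x : 'rV[R]_n | x *m B = 0] = (n - \rank B)%N.
Proof.
apply/eqP; rewrite eqn_leq; apply/andP; split.
  apply/bigmax_leqP => k /asboolP[M Mfree Mker].
  have : (M <= kermx B)%MS.
    apply/sub_kermxP/row_matrixP => i.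
    by rewrite row_mul row0; exact: Mker.
  by move/mxrankS; rewrite mxrank_ker (eqP Mfree).
have kn : (\rank (kermx B) < n.+1)%N by rewrite ltnS rank_leq_row.
rewrite -mxrank_ker; apply: (@leq_bigmax_cond _ _ _ (Ordinal kn)).
apply/asboolP; exists (row_base (kermx B)); first exact: row_base_free.
move=> i; apply/sub_kermxP; apply: submx_trans (row_sub _ _) _.
by rewrite eq_row_base.
Qed.

(** A full-rank factorization [B = C *m D] provides the two matrices, as one-sided
    inverses of [C] and [D].  They extract an invertible compression of size
    [\rank B], which is more convenient than selecting a submatrix. *)
Lemma rank_minor (B : 'M[R]_n) :
  exists (L : 'M[R]_(\rank B, n)) (T : 'M[R]_(n, \rank B)), L *m B *m T = 1%:M.
Proof.
have /row_fullP[L LE] := col_base_full B.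
have /row_freeP[T TE] := row_base_free B.
exists L, T.
transitivity (L *m (col_base B *m row_base B) *m T).
  by rewrite mulmx_base.
by rewrite mulmxA LE mul1mx TE.
Qed.

Lemma rank_of_minor r (L : 'M[R]_(r, n)) (B : 'M[R]_n) (T : 'M[R]_(n, r)) :
  \det (L *m B *m T) != 0 -> (r <= \rank B)%N.
Proof.
move=> detN0; have : L *m B *m T \in unitmx by rewrite unitmxE unitfE.
move=> /mxrank_unit {1}<-.
exact: leq_trans (mxrankM_maxl _ _) (mxrankM_maxr _ _).
Qed.

(** The determinant is the value at [t] of the characteristic polynomial of [- A],
    which is monic and so has finitely many roots. *)
Lemma det_add_scalar_near0 r (A : 'M[R]_r) (e : R) : 0 < e ->
  exists2 t, 0 < t < e & \det (A + t%:M) != 0.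
Proof.
move=> e0; pose p := char_poly (- A).
have pE t : p.[t] = \det (A + t%:M).
  rewrite -horner_evalE -det_map_mx; congr (\det _).
  apply/matrixP => i j; rewrite !mxE /= horner_evalE !hornerE hornerMn hornerX.
  by rewrite opprK addrC.
have p0 : p != 0 by apply: monic_neq0; exact: char_poly_monic.
(* More points of the open interval from 0 to e than the polynomial has roots. *)
pose s := [seq e / i.+2%:R | i <- iota 0 (size p)].
have us : uniq s.
  rewrite map_inj_uniq ?iota_uniq // => i j /(mulfI (lt0r_neq0 e0)) /invr_inj.
  by move/eqP; rewrite eqr_nat => /eqP[].
have : ~~ all (root p) s.
  by apply/negP => /(max_poly_roots p0)/(_ us); rewrite size_map size_iota ltnn.
move=> /allPn[_ /mapP[i _ ->] pt]; exists (e / i.+2%:R).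
  by rewrite divr_gt0 //= ltr_pdivrMr // ltr_pMr // ltr1n.
by rewrite -pE.
Qed.

Variable V : normedModType R.
Variable B : V -> 'M[R]_n.

Lemma rank_lsc (x : V) : (forall i j, continuous (fun v => B v i j)) ->
  \forall y \near x, (\rank (B x) <= \rank (B y))%N.
Proof.
move=> Bc; have [L [T LT]] := rank_minor (B x).
have det_cont : continuous (fun v => \det (L *m B v *m T)).
  have add_cont : continuous (fun z : R * R => z.1 + z.2).
    by move=> z; apply: cvgD; [exact: cvg_fst | exact: cvg_snd].
  have mul_cont : continuous (fun z : R * R => z.1 * z.2).
    by move=> z; apply: cvgM; [exact: cvg_fst | exact: cvg_snd].
  have LB_cont i j : continuous (fun v => (L *m B v) i j).
    under eq_fun do rewrite mxE.
    apply: (continuous_big add_cont) => l _ w; apply: cvgM; first exact: cvg_cst.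
    exact: Bc.
  have mx_cont i j : continuous (fun v => (L *m B v *m T) i j).
    under eq_fun do rewrite mxE.
    apply: (continuous_big add_cont) => k _ v; apply: cvgM; last exact: cvg_cst.
    exact: LB_cont.
  rewrite /determinant.
  apply: (continuous_big add_cont) => s _ v; apply: cvgM; first exact: cvg_cst.
  move: v; apply: (continuous_big mul_cont) => i _; exact: mx_cont.
have : \forall y \near x, \det (L *m B y *m T) != 0.
  apply: (det_cont x [set z | z != 0]); apply: open_nbhs_nbhs; split.
    exact: open_neq.
  by rewrite /= LT det1 oner_neq0.
apply: filterS => y; exact: rank_of_minor.
Qed.

(** On the line through [x1] in the direction [x0], the compression that is the
    identity at [x0] becomes [A + t%:M], invertible for arbitrarily small [t]. *)
Lemma rank_dense (x0 x1 : V) (U : set V) :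
  (forall t u v, B (u + t *: v) = B u + t *: B v) -> open U -> U x1 ->
  exists2 y, U y & (\rank (B x0) <= \rank (B y))%N.
Proof.
move=> Blin oU Ux1; have [L [T LT]] := rank_minor (B x0).
have : \forall t \near (0 : R), U (x1 + t *: x0).
  have : x1 + t *: x0 @[t --> (0 : R)] --> x1 + 0 *: x0.
    by apply: cvgD; [exact: cvg_cst | apply: cvgZr_tmp; exact: cvg_id].
  by rewrite scale0r addr0; apply; exact: open_nbhs_nbhs.
move=> /nbhs_ballP[e /= e0 He].
have [t /andP[t0 te]] := det_add_scalar_near0 (L *m B x1 *m T) e0.
have -> : L *m B x1 *m T + t%:M = L *m B (x1 + t *: x0) *m T.
  by rewrite Blin mulmxDr mulmxDl -scalemxAr -scalemxAl LT scalemx1.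
move=> /rank_of_minor rk; exists (x1 + t *: x0) => //.
by apply: He; rewrite /ball /= sub0r normrN gtr0_norm.
Qed.

End LinearAlgebra.

(** * The adjoint representation in a chart *)

Section LieGroup.
Context {R : realType} {n : nat} {G : lieGroupType R n}.
Implicit Types (c d e : chart R G n) (g h : G) (p q : 'rV[R]_n).

Lemma chart_img_fun c g : chart_dom c g -> chart_img c (c g).
Proof. by move=> cg; exists g. Qed.

Lemma chart_cancel c g : chart_dom c g -> chart_inv c (c g) = g.
Proof. by move=> cg; apply: chart_funK; rewrite inE. Qed.

Lemma chart_invK c p : chart_img c p -> c (chart_inv c p) = p.
Proof. by move=> [g cg <-]; rewrite chart_cancel. Qed.

Lemma chart_inv_dom c p : chart_img c p -> chart_dom c (chart_inv c p).
Proof. by move=> [g cg <-]; rewrite chart_cancel. Qed.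

Lemma near_chart_img c p : chart_img c p -> \forall q \near p, chart_img c q.
Proof.
by move=> cp; apply: open_nbhs_nbhs; split=> //; exact: chart_img_open.
Qed.

Lemma near_chart_dom c g : chart_dom c g -> \forall h \near g, chart_dom c h.
Proof.
by move=> cg; apply: open_nbhs_nbhs; split=> //; exact: chart_dom_open.
Qed.

Lemma chart_inv_cvg c p :
  chart_img c p -> chart_inv c q @[q --> p] --> chart_inv c p.
Proof.
move=> cp; have := @chart_inv_continuous _ _ _ c.
by rewrite continuous_open_subspace; [apply; rewrite inE|exact: chart_img_open].
Qed.

Lemma cvg_mulg (T : Type) (F : set_system T) {FF : Filter F} (u v : T -> G) g h :
  u @ F --> g -> v @ F --> h -> (u x * v x)%g @[x --> F] --> (g * h)%g.
Proof.
move=> ug vh.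
apply: (@continuous2_cvg _ _ _ _ _ _ _ _ (fun x y => x * y)%g) ug vh.
exact: (@lie_mul_continuous _ _ G (g, h)).
Qed.

Lemma cvg_invg (T : Type) (F : set_system T) {FF : Filter F} (u : T -> G) g :
  u @ F --> g -> ((u x)^-1)%g @[x --> F] --> (g^-1)%g.
Proof.
by move=> ug; apply: continuous_cvg ug; exact: (@lie_inv_continuous _ _ G g).
Qed.

Definition chart_mul c d e (z : 'rV[R]_n * 'rV[R]_n) : 'rV[R]_n :=
  e (chart_inv c z.1 * chart_inv d z.2)%g.

Section ChartMul.
Variables (c d e : chart R G n) (p q : 'rV[R]_n).
Hypotheses (ac : lie_atlas c) (ad : lie_atlas d) (ae : lie_atlas e).
Hypotheses (cp : chart_img c p) (dq : chart_img d q).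
Hypothesis epq : chart_dom e (chart_inv c p * chart_inv d q)%g.

Lemma differentiable_chart_mul : differentiable (chart_mul c d e) (p, q).
Proof. by have [+ _] := lie_mul_smooth ac ad ae 1; apply. Qed.

Lemma differentiable_diff_chart_mul v :
  differentiable (fun z => 'd (chart_mul c d e) z v) (p, q).
Proof. by have [_ /(_ v)[+ _]] := lie_mul_smooth ac ad ae 2; apply. Qed.

End ChartMul.

Section FixedChart.
Variable c : chart R G n.
Hypotheses (ac : lie_atlas c) (c1 : chart_dom c 1%g).
Let o := c 1%g.
Let m := chart_mul c c c.
Let i p := c (chart_inv c p)^-1%g.

Definition chart_conj g p := c (g * chart_inv c p * g^-1)%g.

Lemma chart_inv_one : chart_inv c o = 1%g. Proof. exact: chart_cancel. Qed.
Lemma chart_img_one : chart_img c o. Proof. exact: chart_img_fun. Qed.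
Hint Resolve chart_img_one : core.

Lemma chart_conj_one g : chart_conj g o = o.
Proof. by rewrite /chart_conj chart_inv_one mulg1 mulgV. Qed.

Lemma near_chart_dom_mul g d : chart_dom d g ->
  \forall p \near o, chart_dom d (g * chart_inv c p)%g.
Proof.
move=> dg; have : (g * chart_inv c p)%g @[p --> o] --> (g * 1)%g.
  apply: (@cvg_mulg _ (nbhs o)); first exact: cvg_cst.
  by rewrite -chart_inv_one; exact: chart_inv_cvg.
by move/(_ (chart_dom d)); apply; rewrite mulg1; exact: near_chart_dom.
Qed.

Lemma near_chart_dom_conj g :
  \forall p \near o, chart_dom c (g * chart_inv c p * g^-1)%g.
Proof.
have : (g * chart_inv c p * g^-1)%g @[p --> o] --> (g * 1 * g^-1)%g.
  apply: (@cvg_mulg _ (nbhs o)); last exact: cvg_cst.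
  apply: (@cvg_mulg _ (nbhs o)); first exact: cvg_cst.
  by rewrite -chart_inv_one; exact: chart_inv_cvg.
by move/(_ (chart_dom c)); apply; rewrite mulg1 mulgV; exact: near_chart_dom.
Qed.

(** The element [g] need not lie in the domain of [c]: conjugation is factored
    into a left and a right translation through charts around [g] and [g^-1]. *)
Lemma differentiable_chart_conj g : differentiable (chart_conj g) o.
Proof.
have [d ad dg] := (lie_smooth_atlas G).1 g.
have [e ae eg] := (lie_smooth_atlas G).1 (g^-1)%g.
pose L p := chart_mul d c d (d g, p).
have LE p : L p = d (g * chart_inv c p)%g by rewrite /L/chart_mul/= chart_cancel.
have Lo : L o = d g by rewrite LE chart_inv_one mulg1.
have dL : differentiable L o.
  apply: (@differentiable_comp _ _ _ _ (fun p => (d g, p)) (chart_mul d c d)).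
    exact: differentiable_pair.
  apply: differentiable_chart_mul => //; first exact: chart_img_fun.
  by rewrite chart_inv_one mulg1 chart_cancel.
pose K p := chart_mul d e c (L p, e (g^-1)%g).
have dK : differentiable K o.
  apply: (@differentiable_comp _ _ _ _ (fun p => (L p, e (g^-1)%g))
            (chart_mul d e c)); first exact: differentiable_pair.
  rewrite Lo; apply: differentiable_chart_mul => //; try exact: chart_img_fun.
  by rewrite !chart_cancel// mulgV.
apply: (near_eq_diff _ dK).1.
have := near_chart_dom_mul dg; apply: filterS => p dgp.
by rewrite /K /chart_mul /= LE !chart_cancel.
Qed.

Lemma mulmx_Ad (v : 'rV[R]_n) g : v *m Ad c g = 'd (chart_conj g) o v.
Proof. by rewrite /Ad/jacobian mul_rV_lin1. Qed.

(** Matrices act on row vectors from the right, whence the reversed order. *)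
Lemma mulmx_Ad_mul (v : 'rV[R]_n) g h :
  v *m Ad c (g * h)%g = v *m Ad c h *m Ad c g.
Proof.
have dh := differentiable_chart_conj h.
have dg : differentiable (chart_conj g) (chart_conj h o).
  by rewrite chart_conj_one; exact: differentiable_chart_conj.
have dgh : differentiable (fun p => chart_conj g (chart_conj h p)) o.
  exact: (differentiable_comp dh dg).
have Eg := etrans (congr1 (mulmxr (Ad c g)) (mulmx_Ad v h)) (mulmx_Ad _ g).
have Egh := diff_compE v dh dg; rewrite chart_conj_one in Egh.
apply: etrans (mulmx_Ad v (g * h)%g) (etrans _ (etrans Egh (esym Eg))).
apply: near_eq_diffE dgh.
have := near_chart_dom_conj h; apply: filterS => p hp.
by rewrite /chart_conj /= chart_cancel// invgM !mulgA.
Qed.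

Lemma Ad_mul g h : Ad c (g * h)%g = Ad c h *m Ad c g.
Proof.
apply/row_matrixP => j; rewrite !rowE.
by apply: etrans (mulmx_Ad_mul _ g h) _; rewrite mulmxA.
Qed.

Lemma Ad_one : Ad c 1%g = 1%:M.
Proof.
apply/row_matrixP => j; rewrite !rowE mulmx1.
apply: etrans (mulmx_Ad _ _) _.
rewrite (@near_eq_diffE _ _ _ (fun p => p)) ?diff_idE//.
have := near_chart_img chart_img_one; apply: filterS => p cp.
by rewrite /chart_conj mul1g invg1 mulg1 chart_invK.
Qed.

Lemma Ad_mulVK g : Ad c g *m Ad c g^-1%g = 1%:M.
Proof.
by apply: etrans (esym (Ad_mul g^-1%g g)) _; rewrite mulVg; exact: Ad_one.
Qed.

Lemma near_chart_dom_inv : \forall p \near o, chart_dom c (chart_inv c p)^-1%g.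
Proof.
have : ((chart_inv c p)^-1)%g @[p --> o] --> (1^-1 : G)%g.
  by apply: (@cvg_invg _ (nbhs o)); rewrite -chart_inv_one; exact: chart_inv_cvg.
by move/(_ (chart_dom c)); apply; rewrite invg1; exact: near_chart_dom.
Qed.

(** Conjugation by [p] is [q |-> m (m (p, q), i p)]; differentiating in [q] at the
    unit writes [Ad] through first differentials of the multiplication, whose
    dependence on [p] is differentiable. *)
Lemma Ad_chart_formula p (v : 'rV[R]_n) :
  chart_img c p -> chart_dom c (chart_inv c p)^-1%g ->
  v *m Ad c (chart_inv c p) = 'd m (p, i p) ('d m (p, o) (0, v), 0).
Proof.
move=> cp cip; apply: etrans (mulmx_Ad v _) _.
have mpo : m (p, o) = p.
  by rewrite /m /chart_mul /= chart_inv_one mulg1 chart_invK.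
have dm1 : differentiable m (p, o).
  apply: differentiable_chart_mul => //.
  by rewrite chart_inv_one mulg1; exact: chart_inv_dom.
have dm2 : differentiable m (p, i p).
  apply: differentiable_chart_mul => //; first exact: chart_img_fun.
  by rewrite /i chart_cancel// mulgV.
have [dL EL] := is_diff_partial2 v dm1.
have [dK EK] := is_diff_partial1 dL mpo EL dm2.
apply: etrans EK; apply: near_eq_diffE dK.
have := near_chart_dom_mul (chart_inv_dom cp); apply: filterS => q cpq.
by rewrite /m /chart_mul /chart_conj /i /= !chart_cancel.
Qed.

Lemma differentiable_Ad_chart (v : 'rV[R]_n) :
  differentiable (fun p => v *m Ad c (chart_inv c p)) o.
Proof.
pose w p : 'rV[R]_n := 'd m (p, o) (0, v).
have dw : differentiable w o.
  apply: (@differentiable_comp _ _ _ _ (fun p => (p, o)) (fun z => 'd m z (0, v))).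
    exact: differentiable_pair.
  apply: differentiable_diff_chart_mul => //.
  by rewrite chart_inv_one mulg1.
have io : i o = o by rewrite /i chart_inv_one invg1.
have di : differentiable i o.
  have [+ _] := lie_inv_smooth ac ac 1; apply.
  by split=> //; rewrite chart_inv_one invg1.
have dD (u : 'rV[R]_n) : differentiable (fun p => 'd m (p, i p) (u, 0)) o.
  apply: (@differentiable_comp _ _ _ _ (fun p => (p, i p)) (fun z => 'd m z (u, 0))).
    exact: differentiable_pair.
  rewrite io; apply: differentiable_diff_chart_mul => //.
  by rewrite chart_inv_one mulg1.
have df := differentiable_linear_family dD dw.
apply: (near_eq_diff _ df).1.
have := near_chart_img chart_img_one; have := near_chart_dom_inv.
by apply: filterS2 => p cip cp; exact: (esym (Ad_chart_formula v cp cip)).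
Qed.

Lemma lie_bracketDr (x y z : 'rV[R]_n) a :
  lie_bracket c x (a *: y + z) = a *: lie_bracket c x y + lie_bracket c x z.
Proof.
have dy := differentiable_Ad_chart y; have dz := differentiable_Ad_chart z.
apply: etrans (diff_linear_comb a x dy dz).
congr ('d _ _ x); apply/funext => p.
by rewrite mulmxDl scalemxAl.
Qed.

(** Differentiate [Ad (g q g^-1) = Ad g^-1 *m Ad q *m Ad g] with respect to [q] at
    the unit, after multiplication by [y *m Ad g] on the left. *)
Lemma lie_bracket_Ad g (x y : 'rV[R]_n) :
  lie_bracket c (x *m Ad c g) (y *m Ad c g) = lie_bracket c x y *m Ad c g.
Proof.
pose Y p := y *m Ad c g *m Ad c (chart_inv c p).
have dY : differentiable Y (chart_conj g o).
  by rewrite chart_conj_one; exact: differentiable_Ad_chart.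
have dg := differentiable_chart_conj g.
have EY := diff_compE x dg dY; rewrite chart_conj_one in EY.
have EA := diff_mulmxr_comp (Ad c g) x (differentiable_Ad_chart y).
apply: etrans (congr1 ('d Y o) (mulmx_Ad x g)) _.
apply: etrans (esym EY) (etrans _ EA).
apply/esym; apply: near_eq_diffE (differentiable_comp dg dY).
have := near_chart_dom_conj g; apply: filterS => p cgp.
transitivity (y *m Ad c g *m Ad c (g * chart_inv c p * g^-1)%g).
  by apply: (congr1 (fun h => y *m Ad c g *m Ad c h)); exact: chart_cancel.
have Econj := etrans (Ad_mul (g * chart_inv c p)%g g^-1%g)
  (congr1 (mulmx (Ad c g^-1%g)) (Ad_mul g (chart_inv c p))).
exact: mulmx_conj (Ad_mulVK g) Econj.
Qed.

End FixedChart.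
End LieGroup.

(** * The Kirillov matrix of a bilinear bracket *)

Section BracketForm.
Context {R : realType} {n : nat}.
Variable b : 'rV[R]_n -> 'rV[R]_n -> 'rV[R]_n.
Hypothesis b_linearl : forall y, linear (b^~ y).
Hypothesis b_linearr : forall x, linear (b x).

Definition form_mx (xi : 'cV[R]_n) : 'M[R]_n :=
  \matrix_(i, j) pairing xi (b (delta_mx ord0 i) (delta_mx ord0 j)).

Lemma linear_row_sum (f : 'rV[R]_n -> 'rV[R]_n) (x : 'rV[R]_n) :
  linear f -> f x = \sum_i x ord0 i *: f (delta_mx ord0 i).
Proof.
move=> lf; pose fM := GRing.isLinear.Build _ _ _ _ _ lf.
pose fL : {linear _ -> _} := HB.pack f fM.
rewrite {1}[x]row_sum_delta -[f]/(fL : _ -> _) linear_sum.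
by apply: eq_bigr => i _; rewrite linearZ.
Qed.

Lemma form_mxE xi x y :
  pairing xi (b x y) = (x *m form_mx xi *m y^T) ord0 ord0.
Proof.
rewrite (linear_row_sum x (b_linearl y)) /pairing mulmx_suml summxE.
rewrite -mulmxA [RHS]mxE; apply: eq_bigr => i _.
rewrite (linear_row_sum y (b_linearr _)) -scalemxAl mxE mulmx_suml summxE mxE.
congr (_ * _); apply: eq_bigr => j _.
by rewrite -scalemxAl [LHS]mxE [y^T _ _]mxE [form_mx xi _ _]mxE mulrC.
Qed.

(** Testing against the standard basis vectors suffices, by linearity in [y]. *)
Lemma radical_form_mx xi :
  [set x | forall y, pairing xi (b x y) = 0] = [set x | x *m form_mx xi = 0].
Proof.
apply/seteqP; split=> x /= Hx; last first.
  by move=> y; rewrite form_mxE Hx mul0mx mxE.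
apply/rowP => j; have := Hx (delta_mx ord0 j).
by rewrite form_mxE trmx_delta -colE !mxE.
Qed.

(** Invariance of the bracket under [A] moves [A] from the functional to both
    arguments of the form, hence a congruence. *)
Lemma form_mx_mul (A : 'M[R]_n) xi :
  (forall x y, b (x *m A) (y *m A) = b x y *m A) ->
  form_mx (A *m xi) = A *m form_mx xi *m A^T.
Proof.
move=> bA; apply/matrixP => i j.
have -> : form_mx (A *m xi) i j =
    pairing xi (b (delta_mx ord0 i *m A) (delta_mx ord0 j *m A)).
  by rewrite mxE /pairing bA mulmxA.
have entry (N : 'M[R]_n) :
    N i j = ((delta_mx ord0 i : 'rV_n) *m N *m (delta_mx j ord0 : 'cV_n)) ord0 ord0.
  by rewrite -rowE -colE !mxE.
by rewrite form_mxE trmx_mul trmx_delta [RHS]entry !mulmxA.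
Qed.

Lemma form_mx_linear t xi eta :
  form_mx (xi + t *: eta) = form_mx xi + t *: form_mx eta.
Proof.
by apply/matrixP => i j; rewrite !mxE /pairing mulmxDr -scalemxAr !mxE.
Qed.

Lemma form_mx_continuous i j : continuous (fun xi => form_mx xi i j).
Proof.
under eq_fun do rewrite mxE /pairing mxE.
apply: continuous_big => [z|k _ xi].
  by apply: cvgD; [exact: cvg_fst | exact: cvg_snd].
by apply: (@cvgM _ _ (nbhs xi)); [exact: cvg_cst | exact: coord_continuous].
Qed.

Lemma set_dim_radical xi :
  set_dim [set x | forall y, pairing xi (b x y) = 0] = (n - \rank (form_mx xi))%N.
Proof. by rewrite radical_form_mx set_dim_kernel. Qed.

End BracketForm.

Theorem proposition2p4 (R : realType) (n : nat) (G : lieGroupType R n)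
    (c : chart R G n)
    (Gconnected : connected [set: G])
    (Gsimply_connected : simply_connected R G)
    (Gsolvable : solvable_group G)
    (c_atlas : lie_atlas c)
    (c_unit : chart_dom c 1%g)
    (Q : set 'cV[R]_n)
    (Q_quasi_orbit : coad_quasi_orbits c Q)
    (Q_open : open Q) :
  Q `<=` generic_dual c.
Proof.
have brl (y : 'rV[R]_n) : linear ((lie_bracket c)^~ y).
  by move=> a u v; exact: linearP.
have brr (x : 'rV[R]_n) : linear (lie_bracket c x).
  by move=> a u v; exact: lie_bracketDr.
pose B := form_mx (lie_bracket c).
have dimE xi : set_dim (lie_stab c xi) = (n - \rank (B xi))%N.
  exact: set_dim_radical.
have rank_coad g xi : (\rank (B (coad c g xi)) <= \rank (B xi))%N.
  have -> : B (coad c g xi) = Ad c g^-1%g *m B xi *m (Ad c g^-1%g)^T.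
    by apply: form_mx_mul => // x y; exact: lie_bracket_Ad.
  exact: leq_trans (mxrankM_maxl _ _) (mxrankM_maxr _ _).
have orbit_self xi : coad_orbit c xi xi.
  by exists 1%g => //; rewrite /coad invg1 Ad_one// mul1mx.
case: Q_quasi_orbit Q_open => xi _ <- oQ eta Qeta.
(* A point of minimal stabiliser dimension, that is, of maximal rank. *)
have [xi0 xi0min] : exists xi0, set_dim (lie_stab c xi0) = min_stab_dim c.
  by rewrite /min_stab_dim; case: ex_minnP => k /asboolP.
have [zeta Qzeta rk0] :
    exists2 z, coad_quasi_orbit c xi z & (\rank (B xi0) <= \rank (B z))%N.
  by apply: rank_dense oQ Qeta; exact: form_mx_linear.
have zeta_clo : closure (coad_orbit c eta) zeta.
  by rewrite -Qeta Qzeta; apply: subset_closure; exact: orbit_self.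
have [_ [[g _ <-] rkg]] :=
  zeta_clo _ (rank_lsc zeta (@form_mx_continuous _ _ (lie_bracket c))).
rewrite /generic_dual /=; apply/eqP; rewrite eqn_leq; apply/andP; split.
  rewrite -xi0min !dimE leq_sub2l//.
  exact: leq_trans rk0 (leq_trans rkg (rank_coad g eta)).
rewrite /min_stab_dim; case: ex_minnP => k _; apply.
by apply/asboolP; exists eta.
Qed.
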